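(* There exist a tournament $T$, which has a total order $\prec$ of $V(T)$ such that the backedge graph $T^{\prec}$ is a forest, and an integer $k$, such that the tournaments $S$ with $\vec{\omega}(S) \leq k$ that do not contain $T$ as a subtournament have unbounded dichromatic number. (That is, the conjecture that for every such $T$ and every $k$ these tournaments have bounded dichromatic number is false.)
   Context: A tournament is an orientation of a complete graph. For a tournament $T$ and a total order $\prec$ of $V(T)$, the backedge graph $T^{\prec}$ is the undirected graph on $V(T)$ in which $a,b$ with $a \prec b$ are adjacent iff $ba \in A(T)$; $\vec{\omega}(T) = \min_{\prec}\omega(T^{\prec})$ over all total orders. The dichromatic number of a digraph is the minimum number of parts in a partition of its vertex set into sets inducing acyclic subdigraphs. *)

(* Defs.v *)
From mathcomp Require Import all_boot.

Set Implicit Arguments.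
Unset Strict Implicit.
Unset Printing Implicit Defensive.

Record tournament := Tournament {
  vertex :> finType;
  arcs : rel vertex;
  arcs_irreflexive : irreflexive arcs;
  arcs_tournament : forall x y, x != y -> arcs x y (+) arcs y x
}.

(* A (strict) total order is given by the set of its pairs (x, y) with x < y, *)
(* so that orders on a finite type form a finite type.                        *)
Definition total_order (V : finType) (O : {set V * V}) : bool :=
  [&& [forall x, (x, x) \notin O],
      [forall x, forall y, forall z,
         ((x, y) \in O) && ((y, z) \in O) ==> ((x, z) \in O)]
    & [forall x, forall y, (x != y) ==> ((x, y) \in O) || ((y, x) \in O)]].

Definition backedge (T : tournament) (O : {set T * T}) : rel T :=
  fun a b => ((a, b) \in O) && arcs b a || ((b, a) \in O) && arcs a b.

Definition clique (V : finType) (e : rel V) (A : {set V}) : bool :=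
  [forall x in A, forall y in A, (x != y) ==> e x y].

Definition clique_number (V : finType) (e : rel V) : nat :=
  \max_(A : {set V} | clique e A) #|A|.

(* The index set of the minimum is never empty and #|T| bounds all the values *)
(* from above, so the default value #|T| has no effect.                       *)
Definition vec_omega (T : tournament) : nat :=
  \big[minn/#|T|]_(O : {set T * T} | total_order O)
    clique_number (backedge O).

(* For an undirected graph given by a symmetric relation, ucycle e [:: x; y]  *)
(* only says that xy is an edge: genuine cycles have length at least 3.       *)
Definition forest (V : finType) (e : rel V) : Prop :=
  forall s : seq V, ucycle e s -> size s < 3.

(* No directed cycle inside A; the distinct vertices of a cycle number at     *)
(* most #|V|.                                                                 *)
Definition acyclic (V : finType) (e : rel V) (A : {set V}) : bool :=
  ~~ [exists n : 'I_#|V|.+1, exists s : n.-tuple V,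
        [&& 0 < n, all (mem A) s & ucycleb e s]].

(* If e is loopless, the partition into singletons shows that the default     *)
(* value #|V| has no effect.                                                  *)
Definition dichromatic_number (V : finType) (e : rel V) : nat :=
  \big[minn/#|V|]_(P : {set {set V}} |
      partition P [set: V] && [forall A in P, acyclic e A]) #|P|.

Definition subtournament (T S : tournament) : Prop :=
  exists f : T -> S, injective f /\ forall x y, arcs (f x) (f y) = arcs x y.

(* Main.v *)
(** Let [shift n] be the tournament on the pairs (i, j), i < j < n, ordered
    lexicographically, whose backedges are those of the shift graph, i.e. join
    (i, j) to (j, k).  The shift graph is triangle-free, so the clique number is
    at most 2.  The pairs (i, j), (j, k), (k, l) form a directed triangle, so a
    partition into acyclic sets is a colouring of the pairs without monochromatic
    increasing path of length 3; recording, for each point and each colour,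
    whether such paths of length 1 and 2 end there gives n <= 4 ^ c.

    The excluded tournament [hub] consists of vertices z, r1, X1, r2, X2, r3 in
    this order, where X1 and X2 are directed triangles and the only other
    backedges are z r1, z r2, z r3.  If it embeds in [shift n], two of the r's lie
    on the same side of z, and some triangle X satisfies r => X => r' and z => X
    for these two.  A directed triangle contains an edge of the shift graph; but
    the later neighbours of a vertex (i, j) are exactly the pairs with first
    coordinate j, and comparing coordinates shows that X is edgeless. *)

Require Import Defs.
From mathcomp Require Import all_boot zify.

Set Implicit Arguments.
Unset Strict Implicit.
Unset Printing Implicit Defensive.

(** * Bounds on the two invariants *)

Lemma bigminn_leq (I : eqType) (d : nat) (r : seq I) (P : pred I) F i :
  i \in r -> P i -> \big[minn/d]_(j <- r | P j) F j <= F i.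
Proof.
elim: r => // a r IH; rewrite inE big_cons => /predU1P[<- -> | ir Pi].
  exact: geq_minl.
have {}IH := IH ir Pi.
by case: ifP => // _; apply: leq_trans (geq_minr _ _) IH.
Qed.

Lemma vec_omega_leq (T : tournament) (O : {set T * T}) :
  total_order O -> vec_omega T <= clique_number (backedge O).
Proof. by move=> tO; apply: bigminn_leq => //; rewrite mem_index_enum. Qed.

(** The hypothesis [c < #|V|] takes care of the default value of the minimum. *)
Lemma ltn_dichromatic_number (V : finType) (e : rel V) c :
  c < #|V| ->
  (forall P : {set {set V}}, partition P [set: V] ->
     (forall A, A \in P -> acyclic e A) -> c < #|P|) ->
  c < dichromatic_number e.
Proof.
move=> cV cP; apply: (big_ind (fun m => c < m)) => // [m p cm cp | P].
  by rewrite leq_min cm.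
by case/andP=> partP /forall_inP acP; apply: cP.
Qed.

Lemma acyclic_no_triangle (V : finType) (e : rel V) (A : {set V}) x y z :
  acyclic e A -> x \in A -> y \in A -> z \in A -> uniq [:: x; y; z] ->
  ~~ [&& e x y, e y z & e z x].
Proof.
move=> /negP acA xA yA zA xyz; apply/negP => /and3P[exy eyz ezx]; apply: acA.
have lt3 : 3 < #|V|.+1.
  by rewrite ltnS -[3]/(size [:: x; y; z]) -(card_uniqP xyz) max_card.
apply/existsP; exists (Ordinal lt3); apply/existsP; exists [tuple x; y; z].
by rewrite /ucycleb xyz /= xA yA zA exy eyz ezx.
Qed.

(** * Shift tournaments *)

Section Shift.

Variable n : nat.

Definition pairs : finType := {p : 'I_n * 'I_n | p.1 < p.2}.

Definition lo (u : pairs) : nat := (val u).1.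
Definition hi (u : pairs) : nat := (val u).2.

Lemma lo_hi u : lo u < hi u.
Proof. exact: (valP u). Qed.

Lemma pairs_inj u v : lo u = lo v -> hi u = hi v -> u = v.
Proof.
case: u v => [[a b] /= ab] [[c d] /= cd] lo_uv hi_uv.
by apply: val_inj; congr pair; apply: val_inj.
Qed.

Definition lexi (u v : pairs) : bool :=
  (lo u < lo v) || (lo u == lo v) && (hi u < hi v).

(** The last disjunct is the backedge: [hi v = lo u] puts [v] before [u]. *)
Definition shift_arcs (u v : pairs) : bool :=
  lexi u v && (hi u != lo v) || (hi v == lo u).

Lemma shift_irreflexive : irreflexive shift_arcs.
Proof. by move=> u; have := lo_hi u; rewrite /shift_arcs /lexi; lia. Qed.

Lemma shift_tournament u v : u != v -> shift_arcs u v (+) shift_arcs v u.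
Proof.
move=> uv; have : ~ (lo u = lo v /\ hi u = hi v).
  by case=> lo_uv hi_uv; move: uv; rewrite (pairs_inj lo_uv hi_uv) eqxx.
by have := lo_hi u; have := lo_hi v; rewrite /shift_arcs /lexi; lia.
Qed.

Definition shift : tournament := Tournament shift_irreflexive shift_tournament.

Definition lexi_order : {set shift * shift} := [set p | lexi p.1 p.2].

Lemma lexi_total_order : total_order lexi_order.
Proof.
apply/and3P; split.
- by apply/forallP => x; rewrite inE /lexi /=; lia.
- apply/forallP => x; apply/forallP => y; apply/forallP => z.
  by rewrite !inE /lexi /=; lia.
- apply/forallP => x; apply/forallP => y; apply/implyP => xy.
  by have := shift_tournament xy; have := lo_hi x; have := lo_hi y;
    rewrite !inE /shift_arcs /lexi /=; lia.
Qed.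

Lemma backedge_lexi (u v : shift) :
  backedge lexi_order u v -> hi u = lo v \/ hi v = lo u.
Proof.
have := lo_hi u; have := lo_hi v.
by rewrite /backedge !inE /= /shift_arcs /lexi; lia.
Qed.

Lemma vec_omega_shift : vec_omega shift <= 2.
Proof.
apply: leq_trans (vec_omega_leq lexi_total_order) _.
apply/bigmax_leqP => A /forall_inP cliqueA; rewrite leqNgt.
apply/negP => /card_gt2P[x [y [z [[xA yA zA] [xy yz zx]]]]].
have edge u v : u \in A -> v \in A -> u != v -> hi u = lo v \/ hi v = lo u.
  move=> uA vA uv; apply: backedge_lexi.
  exact: implyP (forall_inP (cliqueA u uA) v vA) uv.
(* The other two pairs would both start where the least one ends, so they could not be adjacent. *)
have := edge _ _ xA yA xy; have := edge _ _ yA zA yz; have := edge _ _ zA xA zx.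
by have := lo_hi x; have := lo_hi y; have := lo_hi z; lia.
Qed.

(** The backedges [v u] and [w v] close the forward arc [u w] to a directed triangle. *)
Lemma shift_path_triangle (u v w : shift) : hi u = lo v -> hi v = lo w ->
  uniq [:: u; w; v] /\ [&& arcs u w, arcs w v & arcs v u].
Proof.
move=> uv vw; have := lo_hi u; have := lo_hi v; have := lo_hi w => ww vv uu.
split; last by rewrite /= /shift_arcs /lexi; lia.
rewrite /= !inE negb_or andbT.
apply/andP; split; first (apply/andP; split).
all: by apply/eqP => eq_pairs; move: uv vw ww vv uu; rewrite eq_pairs; lia.
Qed.

(** * Colourings of pairs without increasing monochromatic paths *)

Section Colouring.

Variables (C : finType) (f : pairs -> C).
Hypothesis no_path : forall u v w,
  hi u = lo v -> hi v = lo w -> f u = f v -> f v = f w -> False.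

Definition ends1 (c : C) (i : 'I_n) := [exists u, (hi u == i) && (f u == c)].

Definition ends2 (c : C) (i : 'I_n) :=
  [exists u, [exists v, [&& hi u == lo v, hi v == i, f u == c & f v == c]]].

Lemma colouring_bound : n <= 4 ^ #|C|.
Proof.
pose label i : {ffun C -> bool * bool} := [ffun c => (ends1 c i, ends2 c i)].
suff label_inj : injective label.
  have := leq_card label label_inj.
  by rewrite card_ord card_ffun card_prod card_bool.
have label_lt (i j : 'I_n) : i < j -> label i != label j.
  (* The pair [u] = (i, j) prolongs any path of its colour ending at [i], so equal labels yield
     paths of length 1, 2 and finally 3. *)
  move=> ij; apply/eqP => eq_label; pose u : pairs := Sub (i, j) ij.
  have := congr1 (fun g : {ffun C -> bool * bool} => g (f u)) eq_label.
  rewrite !ffunE => -[eq1 eq2].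
  have : ends1 (f u) j by apply/existsP; exists u; rewrite !eqxx.
  rewrite -eq1 => /existsP[v /andP[/eqP hi_v /eqP fv]].
  have : ends2 (f u) j.
    by apply/existsP; exists v; apply/existsP; exists u; rewrite hi_v fv !eqxx.
  rewrite -eq2 => /existsP[x /existsP[y /and4P[/eqP xy /eqP yi /eqP fx /eqP fy]]].
  by apply: (no_path (u := x) (v := y) (w := u)); rewrite // fx fy.
move=> i j eq_label; apply: val_inj; case: (ltngtP i j) => // lt_ij.
  by have := label_lt i j lt_ij; rewrite eq_label eqxx.
by have := label_lt j i lt_ij; rewrite eq_label eqxx.
Qed.

End Colouring.

Lemma ltn_dichromatic_shift c : 4 ^ c < n -> c < dichromatic_number (@arcs shift).
Proof.
move=> ltcn; apply: ltn_dichromatic_number => [|P partP acP]; rewrite ltnNge.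
  (* Giving each pair its own colour shows that [shift] has more than [c] vertices. *)
  apply/negP => le_c; suff : n <= 4 ^ #|shift|.
    by rewrite leqNgt (leq_ltn_trans _ ltcn) // leq_exp2l.
  apply: (@colouring_bound _ id) => u v w uv _ eq_uv _.
  by have := lo_hi u; rewrite uv eq_uv ltnn.
apply/negP => le_c; suff : n <= 4 ^ #|P|.
  by rewrite leqNgt (leq_ltn_trans _ ltcn) // leq_exp2l.
have covP u : u \in cover P by rewrite (cover_partition partP) inE.
pose block u : {A | A \in P} := Sub (pblock P u) (pblock_mem (covP u)).
have -> : #|P| = #|{: {A | A \in P}}| by rewrite card_sig.
apply: (@colouring_bound _ block) => u v w uv vw [Buv] [Bvw].
have [uniq_uwv tri] := shift_path_triangle uv vw.
have uB : u \in pblock P u by rewrite mem_pblock.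
have vB : v \in pblock P u by rewrite Buv mem_pblock.
have wB : w \in pblock P u by rewrite Buv Bvw mem_pblock.
have := acyclic_no_triangle (acP _ (pblock_mem (covP u))) uB wB vB uniq_uwv.
by rewrite tri.
Qed.

(** * The excluded tournament *)

(** Some arc of a directed triangle goes back in the lexicographic order. *)
Lemma shift_triangle_edge (x y z : shift) : arcs x y -> arcs y z -> arcs z x ->
  exists u v, [/\ u \in [:: x; y; z], v \in [:: x; y; z] & hi u = lo v].
Proof.
move=> xy yz zx; suff : [\/ hi y = lo x, hi z = lo y | hi x = lo z].
  case=> [eq_yx | eq_zy | eq_xz]; [exists y, x | exists z, y | exists x, z];
    by rewrite !inE !eqxx ?orbT.
have := lo_hi x; have := lo_hi y; have := lo_hi z.
move: xy yz zx; rewrite /= /shift_arcs /lexi.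
case: (eqVneq (hi y) (lo x)) => [-> *|_]; first by constructor 1.
case: (eqVneq (hi z) (lo y)) => [-> *|_]; first by constructor 2.
case: (eqVneq (hi x) (lo z)) => [-> *|_]; first by constructor 3.
lia.
Qed.

(** Here [lo r = lo r' = hi z]. A pair lying between [r] and [r'] would start at [hi z] too, and
    then not be dominated by [z]. *)
Lemma no_edge_between_after (z r r' u v : shift) :
  lexi z r -> lexi z r' -> arcs r z -> arcs r' z ->
  (forall x, x \in [:: u; v] -> [&& arcs z x, arcs r x & arcs x r']) ->
  hi u <> lo v.
Proof.
move=> zr zr' r_z r'_z X uv.
have sep x : x \in [:: u; v] -> hi x = hi z \/ lo x = hi r'.
  move=> /X; move: zr zr' r_z r'_z; rewrite /= /shift_arcs /lexi.
  by have := lo_hi x; have := lo_hi z; have := lo_hi r; have := lo_hi r'; lia.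
have := sep u; have := sep v; rewrite !inE !eqxx orbT /= => /(_ isT) sv /(_ isT) su.
have := lo_hi u; have := lo_hi v; have := lo_hi r'; have := lo_hi z.
by move: zr' r'_z; rewrite /= /shift_arcs /lexi; lia.
Qed.

(** Pairs on the same side of [z] share an endpoint. An edge across [z] would need [hi r' = lo z],
    which reverses the arc [r' z]. *)
Lemma no_edge_between_before (z r' u v : shift) :
  lexi r' z -> arcs r' z ->
  (forall x, x \in [:: u; v] -> arcs z x && arcs x r') ->
  hi u <> lo v.
Proof.
move=> r'z r'_z X uv.
have sep x : x \in [:: u; v] ->
    lexi x z /\ hi x = lo z \/ lexi z x /\ lo x = hi r'.
  move=> /X; move: r'z r'_z; rewrite /= /shift_arcs /lexi.
  by have := lo_hi x; have := lo_hi z; have := lo_hi r'; lia.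
have := sep u; have := sep v; rewrite !inE !eqxx orbT /= => /(_ isT) sv /(_ isT) su.
move: su sv r'z r'_z; rewrite /= /shift_arcs /lexi.
by have := lo_hi u; have := lo_hi v; have := lo_hi r'; have := lo_hi z; lia.
Qed.

Lemma shift_separated (z r r' x y w : shift) :
  arcs r z -> arcs r' z -> arcs x y -> arcs y w -> arcs w x ->
  (forall t, t \in [:: x; y; w] -> [&& arcs z t, arcs r t & arcs t r']) ->
  lexi z r != lexi z r'.
Proof.
move=> rz r'z xy yw wx X; apply/negP => /eqP same_side.
have [u [v [uX vX uv]]] := shift_triangle_edge xy yw wx.
have {}X t : t \in [:: u; v] -> [&& arcs z t, arcs r t & arcs t r'].
  by rewrite !inE => /orP[] /eqP->; apply: X.
case zr': (lexi z r').
  by apply: (no_edge_between_after _ zr' rz r'z X uv); rewrite same_side.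
apply: (no_edge_between_before _ r'z _ uv) => [|t /X/and3P[-> _ ->] //].
have := lo_hi r'; have := lo_hi z.
by move: r'z zr'; rewrite /= /shift_arcs /lexi; lia.
Qed.

End Shift.

(* z = 0, r1 = 1, X1 = {2, 3, 4}, r2 = 5, X2 = {6, 7, 8}, r3 = 9 *)
Definition hub_back (a b : nat) : bool :=
  (a, b) \in [:: (0, 1); (0, 5); (0, 9); (2, 4); (6, 8)].

Lemma hub_back_ltn a b : hub_back a b -> a < b.
Proof. by rewrite /hub_back !inE => /or4P[||| /orP[]] /eqP[-> ->]. Qed.

Definition hub_arcs : rel 'I_10 :=
  fun a b => (a < b) && ~~ hub_back a b || hub_back b a.

Lemma hub_irreflexive : irreflexive hub_arcs.
Proof.
by move=> a; apply/negP; rewrite /hub_arcs ltnn => /hub_back_ltn; rewrite ltnn.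
Qed.

Lemma hub_tournament a b : a != b -> hub_arcs a b (+) hub_arcs b a.
Proof.
rewrite -val_eqE /= /hub_arcs; have := @hub_back_ltn a b; have := @hub_back_ltn b a.
by case: (hub_back a b); case: (hub_back b a); case: ltngtP => //= _ h h';
  move: (h isT) || move: (h' isT).
Qed.

Definition hub : tournament := Tournament hub_irreflexive hub_tournament.

Definition hub_order : {set hub * hub} :=
  [set p | nat_of_ord p.1 < nat_of_ord p.2].

Lemma hub_total_order : total_order hub_order.
Proof.
apply/and3P; split.
- by apply/forallP => x; rewrite inE /= ltnn.
- apply/forallP => x; apply/forallP => y; apply/forallP => z.
  by rewrite !inE /=; apply/implyP => /andP[]; apply: ltn_trans.
- apply/forallP => x; apply/forallP => y; apply/implyP.
  by rewrite !inE /= -val_eqE /= neq_ltn.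
Qed.

Lemma backedge_hubE (a b : hub) :
  backedge hub_order a b =
  hub_back (nat_of_ord a) (nat_of_ord b) || hub_back (nat_of_ord b) (nat_of_ord a).
Proof.
rewrite /backedge !inE /= /hub_arcs.
have := @hub_back_ltn a b; have := @hub_back_ltn b a.
by case: (hub_back a b); case: (hub_back b a); case: ltngtP => //= _ h h';
  move: (h isT) || move: (h' isT).
Qed.

(** The backedges form a star with centre 0 and leaves 1, 5, 9, and two disjoint edges away from
    it. *)
Lemma hub_leaf (a b c : hub) : backedge hub_order b a -> backedge hub_order b c ->
  a != c -> nat_of_ord b = 0.
Proof.
rewrite !backedge_hubE -val_eqE /=.
move: (nat_of_ord a) (nat_of_ord b) (nat_of_ord c) => x y z.
rewrite /hub_back !inE !xpair_eqE.
by case/orP=> /or4P[||| /orP[]] /andP[/eqP-> /eqP->] //=;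
  rewrite ?andbF ?andbT ?orbF //= => /eqP->.
Qed.

(* Two consecutive vertices of a cycle have degree at least 2, but only the
   vertex 0 does. *)
Lemma hub_forest : forest (backedge hub_order).
Proof.
have sym a b : backedge hub_order a b = backedge hub_order b a.
  by rewrite !backedge_hubE orbC.
have two_hubs (b c : hub) : b != c ->
    nat_of_ord b = 0 -> nat_of_ord c = 0 -> False.
  by move=> bc b0 c0; case/eqP: bc; apply: val_inj; rewrite /= b0 c0.
case=> [|a [|b [|c s]]] // /andP[].
(* After [b] and [c] the cycle returns to [a] if its length is 3, and goes on to [d] otherwise. *)
case: s => [|d s] /=; rewrite !inE !negb_or.
- case/and4P=> ab bc ca _ /and3P[/andP[nab nac] nbc _].
  case: (two_hubs b c nbc).
    by apply: (hub_leaf (a := a) (c := c)); rewrite // sym.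
  by apply: (hub_leaf (a := a) (c := b)); rewrite // sym.
- case/and4P=> ab bc cd _ /and3P[/and4P[nab nac _ _] /and3P[nbc nbd _] _].
  case: (two_hubs b c nbc).
    by apply: (hub_leaf (a := a) (c := c)); rewrite // sym.
  by apply: (hub_leaf (a := b) (c := d)); rewrite // sym.
Qed.

Lemma hub_not_subtournament n : ~ subtournament hub (shift n).
Proof.
case=> f [_ f_arcs]; pose z : hub := @ord0 9.
pose v k (lt_k : k < 10) : hub := Ordinal lt_k.
have side (r r' x y w : hub) :
    [&& arcs r z, arcs r' z, arcs x y, arcs y w & arcs w x] ->
    all [pred t | [&& arcs z t, arcs r t & arcs t r']] [:: x; y; w] ->
    lexi (f z) (f r) != lexi (f z) (f r').
  case/and5P=> rz r'z xy yw wx /allP X.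
  apply: (@shift_separated _ (f z) (f r) (f r') (f x) (f y) (f w)).
  1-5: by rewrite f_arcs.
  move=> t; rewrite -[[:: f x; f y; f w]]/(map f [:: x; y; w]) => /mapP[s sX ->].
  by rewrite !f_arcs; apply: X.
have := side (v 1 isT) (v 5 isT) (v 2 isT) (v 3 isT) (v 4 isT) isT isT.
have := side (v 5 isT) (v 9 isT) (v 6 isT) (v 7 isT) (v 8 isT) isT isT.
have := side (v 1 isT) (v 9 isT) (v 2 isT) (v 3 isT) (v 4 isT) isT isT.
(* Pigeonhole: three vertices cannot lie on pairwise different sides of [z]. *)
by do 3!case: (lexi _ _).
Qed.

Theorem theorem4p2 :
  exists (T : tournament) (k : nat),
    (exists O : {set T * T}, total_order O /\ forest (backedge O)) /\
    (forall c : nat, exists S : tournament,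
       [/\ vec_omega S <= k, ~ subtournament T S
         & c < dichromatic_number (@arcs S)]).
Proof.
exists hub, 2; split.
  by exists hub_order; split; [apply: hub_total_order | apply: hub_forest].
move=> c; exists (shift (4 ^ c).+1); split.
- exact: vec_omega_shift.
- exact: hub_not_subtournament.
- exact: ltn_dichromatic_shift.
Qed.
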